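(* Let $t\geq 2$ be an integer and let $\vec G$ be a digraph with minimum out-degree at least $t$. Then $\vec G$ contains either a subdivision of $\vec W_t^1$ or a subdivision of $\vec W_{t+1}^2$. In particular, $\vec G$ contains both a subdivision of $\vec C_t^+$ and a subdivision of $\vec W_t^2$.
   Context: All digraphs are finite, nonempty and simple: no loops and no two distinct arcs with the same tail and the same head (two arcs with opposite directions between the same pair of vertices are allowed). A digraph contains a subdivision of $\vec F$ if it has a subdigraph isomorphic to a digraph obtained from $\vec F$ by replacing each arc $(u,v)$ by a directed path from $u$ to $v$ of length at least one, these paths being internally disjoint from each other and from $V(\vec F)$. $\vec C_t$ is the directed cycle on $t$ vertices (for $t=2$, two vertices joined by two opposite arcs). $\vec C_t^+$ is obtained from $\vec C_t$ by adding a new vertex (the apex source) and arcs from it to every vertex of $\vec C_t$. $\vec W_t^1$ is obtained from $\vec C_t^+$ by adding an additional arc from one vertex on the cycle to the apex source. $\vec W_t^2$ is obtained from $\vec C_t^+$ by reversing the orientation of one arc from the apex source to the cycle. *)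

(* Defs.v *)
From mathcomp Require Import all_boot.
Set Implicit Arguments.
Unset Strict Implicit.
Unset Printing Implicit Defensive.

(* A boolean relation on a finType rules out parallel arcs with the same
   direction; looplessness is the predicate [loopless]. *)
Record digraph := Digraph { vertex :> finType; arc : rel vertex }.
Arguments arc : clear implicits.

Definition loopless (G : digraph) : Prop := irreflexive (arc G).

Definition outdeg (G : digraph) (v : G) : nat := #|[set w | arc G v w]|.

Definition arcs (F : digraph) := {e : F * F | arc F e.1 e.2}.
Definition tail (F : digraph) (e : arcs F) : F := (val e).1.
Definition head (F : digraph) (e : arcs F) : F := (val e).2.

(* The digraph obtained from F by replacing each arc e by a directed path
   with [l e] new internal vertices, i.e. of length [(l e).+1]; the vertex
   [inr (Tagged _ i)] over e is the internal vertex number i of that path. *)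
Definition subdiv_vertex (F : digraph) (l : arcs F -> nat) : finType :=
  (F + {e : arcs F & 'I_(l e)})%type.

Definition subdiv_arc (F : digraph) (l : arcs F -> nat) :
    rel (subdiv_vertex l) := fun x y =>
  match x, y with
  | inl u, inl v =>
      [exists e : arcs F, [&& tail e == u, head e == v & l e == 0]]
  | inl u, inr q => (tail (tag q) == u) && (tagged q == 0 :> nat)
  | inr p, inl v => (head (tag p) == v) && ((tagged p).+1 == l (tag p))
  | inr p, inr q =>
      (tag p == tag q) && (tagged q == (tagged p).+1 :> nat)
  end.

Definition subdivision (F : digraph) (l : arcs F -> nat) : digraph :=
  Digraph (@subdiv_arc F l).

(* H is isomorphic to a (not necessarily induced) subdigraph of G, namely to
   the image of f. *)
Definition embeds (H G : digraph) : Prop :=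
  exists2 f : H -> G, injective f & {homo f : x y / arc H x y >-> arc G x y}.

Definition contains_subdivision (G F : digraph) : Prop :=
  exists l : arcs F -> nat, embeds (subdivision l) G.

(* [ordS] is the cyclic successor; meaningful for t >= 2 (a loop for t = 1). *)
Definition dicycle (t : nat) : digraph := Digraph (frel (@ordS t)).

(* In the three digraphs below, the apex source is [None] and the cycle vertices
   are [Some i]. By the rotational symmetry of the cycle, the distinguished
   cycle vertex can be taken to be 0. *)
Definition cycle_plus_arc (t : nat) : rel (option 'I_t) := fun x y =>
  match x, y with
  | Some i, Some j => arc (dicycle t) i j
  | None, Some _ => true
  | _, None => false
  end.

Definition cycle_plus (t : nat) : digraph := Digraph (@cycle_plus_arc t).

Definition wheel1_arc (t : nat) : rel (option 'I_t) := fun x y =>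
  match x, y with
  | Some i, None => i == 0 :> nat
  | _, _ => arc (cycle_plus t) x y
  end.

Definition wheel1 (t : nat) : digraph := Digraph (@wheel1_arc t).

Definition wheel2_arc (t : nat) : rel (option 'I_t) := fun x y =>
  match x, y with
  | Some i, None => i == 0 :> nat
  | None, Some i => i != 0 :> nat
  | _, _ => arc (cycle_plus t) x y
  end.

Definition wheel2 (t : nat) : digraph := Digraph (@wheel2_arc t).

(* Main.v *)
From mathcomp Require Import all_boot.
Require Import Defs.
Set Implicit Arguments.
Unset Strict Implicit.
Unset Printing Implicit Defensive.

(* Both wheels amount to a cycle C, an arc from C to a vertex v outside C, and a
   fan of t paths from v to C, disjoint except at v: the outcome is W_t^1 or
   W_{t+1}^2 according to whether the tail of the arc is an endpoint of the fan.

   Inside an inclusion-minimal nonempty set closed under out-neighbours, take a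
   cycle C, an arc from c in C to v outside C, and a set X that contains v, is
   disjoint from C and has an out-boundary of minimum size k. If k >= t,
   Menger's theorem gives the fan. If k < t, it gives a fan of k > 0 paths, and
   its first endpoint w after c along C yields a new cycle C': the arc to v, the
   fan path to w, and C from w to c. It contains every fan endpoint. As v has
   out-degree at least t > k, it has an out-neighbour y in X outside C'. If X0
   is a set of minimum boundary for (y, C'), the boundary of X :|: X0 meets
   every fan path, so has size at least k, and by submodularity X :&: X0 is
   again of minimum boundary for (y, C'). It is smaller than X, as it misses
   v. *)

(** * Menger's theorem *)

Definition separates (T : finType) (e : rel T) (A B S : {set T}) : Prop :=
  forall x p, x \in A -> path e x p -> last x p \in B -> has [in S] (x :: p).

(** The elements of [I] merely label the paths: path [i] starts at [h i] and continues through
    [P i]. Labels are vertices, so that a path can be relabelled by one of its own vertices. *)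
Definition linkage (T : finType) (e : rel T) (A B I : {set T})
    (h : T -> T) (P : T -> seq T) : Prop :=
  (forall i, i \in I -> [/\ h i \in A, path e (h i) (P i),
     last (h i) (P i) \in B & uniq (h i :: P i)]) /\
  (forall i j z, i \in I -> j \in I -> z \in h i :: P i -> z \in h j :: P j ->
     i = j).

Lemma linkage_sub (T : finType) (e e' : rel T) A B I h P :
  subrel e' e -> @linkage T e' A B I h P -> linkage e A B I h P.
Proof.
move=> se [H D]; split=> // i /H[hA pth lB u]; split=> //.
exact: sub_path pth.
Qed.

Lemma linkage_shorten (T : finType) (e : rel T) (A B I : {set T})
    (h : T -> T) (P : T -> seq T) :
  (forall i, i \in I -> [/\ h i \in A, path e (h i) (P i)
     & last (h i) (P i) \in B]) ->
  (forall i j z, i \in I -> j \in I -> z \in h i :: P i -> z \in h j :: P j ->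
     i = j) ->
  exists P', linkage e A B I h P'.
Proof.
move=> H D; exists (fun i => shorten (h i) (P i)).
have sh i : i \in I -> {subset h i :: shorten (h i) (P i) <= h i :: P i}.
  move=> /H[_ pth _] z; case: (shortenP pth) => p' _ _ sub.
  by rewrite !inE => /predU1P[->|/sub->]; rewrite ?eqxx ?orbT.
split=> [i /[dup] iI /H[hA pth lB]|i j z iI jI /(sh i iI) zi /(sh j jI) zj].
  by case: (shortenP pth) lB => p' ? ? _ ?; split.
exact: D zi zj.
Qed.

(** Disjointness makes [f] injective on [I], and then [#|Z| <= #|I|] makes it a bijection onto [Z],
    so each path can be relabelled by a vertex on it. *)
Lemma linkage_reindex (T : finType) (e : rel T) (A B I Z : {set T})
    (h f : T -> T) (P : T -> seq T) :
  linkage e A B I h P -> (forall i, i \in I -> f i \in Z) ->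
  (forall i, i \in I -> f i \in h i :: P i) -> #|Z| <= #|I| ->
  exists h' P', linkage e A B Z h' P' /\ forall z, z \in Z ->
    exists2 i, i \in I & [/\ f i = z, h' z = h i & P' z = P i].
Proof.
move=> [H D] fZ fP leZ.
have finj : {in I &, injective f}.
  move=> i j iI jI fij; apply: (D i j (f i)) => //; first exact: fP.
  by rewrite fij; exact: fP.
have imZ : f @: I = Z.
  apply/eqP; rewrite eqEcard card_in_imset // leZ andbT.
  by apply/subsetP=> _ /imsetP[i iI ->]; exact: fZ.
pose g z := odflt z [pick i in I | f i == z].
have gP z : z \in Z -> g z \in I /\ f (g z) = z.
  rewrite -imZ /g => /imsetP[i iI zE]; case: pickP => [j /andP[jI /eqP]|] //=.
  by move/(_ i); rewrite zE eqxx iI.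
exists (h \o g), (P \o g); split; last first.
  by move=> z /gP[gI fg]; exists (g z).
split=> [z /gP[gI fg]|z z' u /gP[gI fg] /gP[gI' fg'] uz uz']; first exact: H.
by rewrite -fg -fg' (D _ _ u gI gI').
Qed.

Definition del_arc (T : finType) (e : rel T) (x y : T) : rel T :=
  fun u v => e u v && ((u, v) != (x, y)).

(** A path cannot use the arc [x -> y] before visiting [x], so cutting it at its first vertex in
    [x |: S] leaves a path without that arc. *)
Lemma prefix_to (T : finType) (e : rel T) (S : {set T}) (x y a : T) p :
  path e a p ->
  (exists q, [/\ path (del_arc e x y) a q, last a q \in x |: S
     & {subset a :: q <= a :: p}])
  \/ path (del_arc e x y) a p /\ ~~ has [in x |: S] (a :: p).
Proof.
elim: p a => [|w p IH] a /=; case: (boolP (a \in x |: S)) => aS.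
- by left; exists [::]; split.
- by right.
- by left; exists [::]; split=> // z; rewrite inE => /eqP->; exact: mem_head.
case/andP=> eaw pth.
have e'aw : del_arc e x y a w.
  rewrite /del_arc eaw xpair_eqE negb_and.
  by move: aS; rewrite !inE => /norP[->].
case: (IH w pth) => [[q [q1 q2 q3]]|[q1 q2]].
  left; exists (w :: q); split=> //=; first by rewrite e'aw.
  move=> z; rewrite in_cons => /predU1P[->|/q3]; first by rewrite mem_head.
  by rewrite [in X in _ -> X]in_cons => ->; rewrite orbT.
by right; split; [rewrite e'aw | exact: q2].
Qed.

(** Mirror image: after its last visit to [y |: S] a path no longer uses [x -> y], since that would
    enter [y]. *)
Lemma suffix_from (T : finType) (e : rel T) (S : {set T}) (x y a : T) p :
  path e a p ->
  (exists z q, [/\ z \in y |: S, path (del_arc e x y) z q, last z q = last a p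
     & {subset z :: q <= a :: p}])
  \/ path (del_arc e x y) a p /\ ~~ has [in y |: S] (a :: p).
Proof.
elim: p a => [|w p IH] a /=.
  case: (boolP (a \in y |: S)) => aS _; last by right; rewrite orbF.
  by left; exists a, [::]; split.
case/andP=> eaw /IH[[z [q [q1 q2 q3 q4]]]|[q1 q2]].
  left; exists z, q; split=> // u /q4.
  by rewrite [in X in _ -> X]in_cons => ->; rewrite orbT.
have e'aw : del_arc e x y a w.
  rewrite /del_arc eaw xpair_eqE negb_and.
  have /hasPn/(_ w (mem_head _ _)) := q2.
  by rewrite !inE => /norP[->]; rewrite orbT.
case: (boolP (a \in y |: S)) => aS.
  by left; exists a, (w :: p); split; rewrite //= e'aw q1.
by right; split; [rewrite e'aw q1 | exact: q2].
Qed.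

(** The first path up to [u], followed by the second from [u] on, leads from [A] to [B] and so meets
    [S] at some [s]. The first path can meet [S] only at its end and the second only at its start,
    so the absence of repetitions forces [s = u]. *)
Lemma path_cross (T : finType) (e : rel T) (A B S : {set T}) h1 p1 z2 p2 u :
  separates e A B S -> h1 \in A -> path e h1 p1 -> uniq (h1 :: p1) ->
  path e z2 p2 -> uniq (z2 :: p2) -> last z2 p2 \in B ->
  (forall s, s \in S -> s \in h1 :: p1 -> s = last h1 p1) ->
  (forall s, s \in S -> s \in z2 :: p2 -> s = z2) ->
  u \in h1 :: p1 -> u \in z2 :: p2 ->
  u \in S.
Proof.
move=> sep hA pa u1 pb u2 lB H1 H2 up uq.
case/splitPl: up pa u1 H1 => p11 p12 lu; rewrite cat_path lu => /andP[pa _].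
rewrite last_cat lu => u1 H1; case/splitPl: uq pb u2 lB H2 => q1 q2 lu2.
rewrite cat_path lu2 => /andP[_ pb] u2; rewrite last_cat lu2 => lB H2.
have /(sep _ _ hA) : path e h1 (p11 ++ q2) by rewrite cat_path pa lu.
rewrite last_cat lu => /(_ lB) /hasP[s].
rewrite -cat_cons mem_cat => /orP[sp|sq] sS.
  have /(H1 s sS) sE : s \in h1 :: p11 ++ p12 by rewrite -cat_cons mem_cat sp.
  case: p12 {H1} u1 sE => [|b p12] u1 sE; first by rewrite -[u]sE.
  have sb : s \in b :: p12 by rewrite sE /= mem_last.
  by move: u1; rewrite -cat_cons cat_uniq => /and3P[_ /hasPn/(_ s sb)/negP].
have sE : s = z2 by apply: H2; rewrite // -cat_cons mem_cat sq orbT.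
case: q1 lu2 u2 {H2} => [/= <-|b q1 /= lu2]; first by rewrite -sE.
by rewrite -sE -cat_cons mem_cat sq orbT.
Qed.

(* Goering's proof: either deleting an arc [x -> y] keeps all separators large,
   or a small separator [S] appears and linkages into [x |: S] and out of
   [y |: S] are glued along [S] and [x -> y]. *)
Lemma menger (T : finType) (e : rel T) (A B : {set T}) k :
  (exists2 S, separates e A B S & #|S| < k) \/
  (exists (I : {set T}) h P, #|I| = k /\ linkage e A B I h P).
Proof.
have [n] := ubnP #|[set uv : T * T | e uv.1 uv.2]|.
elim: n => // n IH in e A B *; rewrite ltnS => len.
have [[x y] /= exy|no_arc] := pickP [pred uv : T * T | e uv.1 uv.2]; last first.
  (* Without arcs every path is a single vertex, so [A :&: B] is a separator and also supplies the
     disjoint paths. *)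
  have no_path x p : path e x p -> p = [::].
    by case: p => //= y p /andP[exy _]; have := no_arc (x, y); rewrite /= exy.
  have [ltk|lek] := ltnP #|A :&: B| k.
    left; exists (A :&: B) => // x p xA /no_path-> /= xB.
    by rewrite inE xA xB.
  right; exists [set z in take k (enum (A :&: B))], id, (fun=> [::]); split.
    rewrite cardsE (card_uniqP _) ?take_uniq ?enum_uniq //.
    by rewrite size_takel // -cardE.
  split=> [i|i j z _ _]; last by rewrite !inE => /eqP<- /eqP.
  by rewrite inE => /mem_take; rewrite mem_enum inE => /andP[].
set e' := del_arc e x y.
have se : subrel e' e by move=> u v /andP[].
have lt' : #|[set uv : T * T | e' uv.1 uv.2]| < n.
  apply: leq_trans len; apply: proper_card; apply/properP; split.
    by apply/subsetP=> uv; rewrite !inE => /se.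
  by exists (x, y); rewrite inE //= /e' /del_arc eqxx andbF.
have {}IH A' B' := IH e' A' B' lt'.
have [[S sepS ltS]|[I [h [P [kI lk]]]]] := IH A B; last first.
  by right; exists I, h, P; split=> //; apply: linkage_sub lk.
(* Every path of [e] from [A] to [B] contains a path of [e'] from [A] to [x |: S]: otherwise it
   would be a path of [e'] missing [S]. So a small separator for the latter paths also serves for
   the former. *)
have [[S1 sep1 lt1]|[I1 [h1 [P1 [k1 lk1]]]]] := IH A (x |: S).
  left; exists S1 => // a p aA pth lB.
  have [[q [q1 q2 q3]]|[q1 /hasPn q2]] := prefix_to S x y pth.
    have /hasP[s /q3 sp sS] := sep1 a q aA q1 q2.
    by apply/hasP; exists s.
  have /hasP[s /q2] := sepS a p aA q1 lB.
  by rewrite !inE negb_or => /andP[_ /negPf->].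
have [[S1 sep1 lt1]|[I2 [h2 [P2 [k2 lk2]]]]] := IH (y |: S) B.
  left; exists S1 => // a p aA pth lB.
  have [[z [q [q1 q2 q3 q4]]]|[q1 /hasPn q2]] := suffix_from S x y pth.
    have /hasP[s /q4 sp sS] : has [in S1] (z :: q).
      by apply: sep1; rewrite // q3.
    by apply/hasP; exists s.
  have /hasP[s /q2] := sepS a p aA q1 lB.
  by rewrite !inE negb_or => /andP[_ /negPf->].
right.
have [h1' [P1' [lk1' E1]]] : exists h' P',
    linkage e' A (x |: S) (x |: S) h' P' /\
    forall z, z \in x |: S -> exists2 i, i \in I1 &
      [/\ last (h1 i) (P1 i) = z, h' z = h1 i & P' z = P1 i].
  apply: (linkage_reindex lk1) => [i iI|i|]; first by case: lk1 => /(_ i iI)[].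
    by rewrite mem_last.
  by rewrite k1 cardsU1; case: (x \in S); rewrite /= ?add0n ?(ltnW ltS).
have [h2' [P2' [lk2' E2]]] : exists h' P',
    linkage e' (y |: S) B (y |: S) h' P' /\
    forall z, z \in y |: S -> exists2 i, i \in I2 &
      [/\ h2 i = z, h' z = h2 i & P' z = P2 i].
  apply: (linkage_reindex lk2) => [i iI|i|]; first by case: lk2 => /(_ i iI)[].
    by rewrite mem_head.
  by rewrite k2 cardsU1; case: (y \in S); rewrite /= ?add0n ?(ltnW ltS).
have [H1 D1] := lk1'; have [H2 D2] := lk2'.
have L1 z : z \in x |: S -> last (h1' z) (P1' z) = z.
  by case/E1=> i _ [<- -> ->].
have L2 z : z \in y |: S -> h2' z = z by case/E2=> i _ [<- -> _].
have card_le z : k <= #|z |: S| -> z \notin S.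
  by rewrite cardsU1 leqNgt; apply: contra => ->.
(* The [k] disjoint paths have distinct ends in [x |: S], while [#|S| < k]; hence [x] is outside
   [S]. For [y] the starts are counted instead. *)
have kx : k <= #|x |: S|.
  rewrite -k1 -(card_in_imset (f := fun i => last (h1 i) (P1 i))).
    apply: subset_leq_card; apply/subsetP=> _ /imsetP[i iI ->].
    by case: lk1 => /(_ i iI)[].
  case: lk1 => _ D i j iI jI ij; apply: (D i j (last (h1 i) (P1 i))) => //.
    exact: mem_last.
  by rewrite ij mem_last.
have xS : x \notin S by exact: card_le.
have yS : y \notin S.
  apply: card_le; rewrite -k2 -(card_in_imset (f := h2)).
    apply: subset_leq_card; apply/subsetP=> _ /imsetP[i iI ->].
    by case: lk2 => + _ => /(_ i iI)[].
  case: lk2 => _ D i j iI jI ij.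
  by apply: (D i j (h2 i)); rewrite // ?ij mem_head.
have cross z z2 u : z \in x |: S -> z2 \in y |: S -> u \in h1' z :: P1' z ->
    u \in h2' z2 :: P2' z2 -> [/\ u \in S, z = u & z2 = u].
  move=> zS z2S uz uz2.
  have [hA pa _ ua] := H1 z zS; have [_ pb lB ub] := H2 z2 z2S.
  have SS w s : s \in S -> s \in w |: S by rewrite !inE orbC => ->.
  have uS : u \in S.
    apply: (path_cross sepS hA pa ua pb ub lB) uz uz2 => s sS sp.
      rewrite L1 //; apply: (D1 _ _ s) => //; first exact: SS.
      by rewrite -{1}(L1 s (SS x s sS)) mem_last.
    rewrite L2 //; apply: (D2 _ _ s) => //; first exact: SS.
    by rewrite -{1}(L2 s (SS y s sS)) mem_head.
  split=> //.
    apply: (D1 _ _ u) => //; first exact: SS.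
    by rewrite -{1}(L1 u (SS x u uS)) mem_last.
  apply: (D2 _ _ u) => //; first exact: SS.
  by rewrite -{1}(L2 u (SS y u uS)) mem_head.
(* A path ending at [x] continues over the arc [x -> y]; a path ending in [S] continues from the
   same vertex. *)
pose sg z := if z == x then y else z.
pose P z := P1' z ++ (if z == x then y :: P2' y else P2' z).
have sgS z : z \in x |: S -> sg z \in y |: S.
  by rewrite /sg !inE; case: (z =P x) => [_ _|_ /= ->]; rewrite ?eqxx ?orbT.
have sgE z : sg z \in S -> sg z = z.
  by rewrite /sg; case: eqP => // _ /(negP yS).
have PE z u : z \in x |: S -> u \in h1' z :: P z ->
    u \in h1' z :: P1' z \/ u \in h2' (sg z) :: P2' (sg z).
  move=> zS; rewrite -cat_cons mem_cat => /orP[->|]; first by left.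
  rewrite /sg; case: ifP => _ uP; right; last by rewrite in_cons uP orbT.
  by rewrite L2 // !inE eqxx.
exists (x |: S).
have [P' lk] : exists P', linkage e A B (x |: S) h1' P'; last first.
  exists h1', P'; split=> //; apply/eqP; rewrite eqn_leq kx andbT.
  by rewrite cardsU1 xS.
apply: (@linkage_shorten _ _ _ _ _ _ P).
  move=> z zS; have [hA pa la _] := H1 z zS.
  have [_ pb lb _] := H2 _ (sgS z zS).
  split=> //.
    rewrite cat_path (sub_path se pa) L1 //=.
    move: pb; rewrite (L2 _ (sgS z zS)) /sg.
    case: eqP => [->|_] /(sub_path se) //= ->.
    by rewrite exy.
  rewrite last_cat L1 //; move: lb; rewrite (L2 _ (sgS z zS)) /sg.
  by case: eqP.
move=> z z' u zS z'S /(PE z u zS) [uz|uz] /(PE z' u z'S) [uz'|uz'].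
- exact: D1 uz uz'.
- by have [uS -> E] := cross _ _ _ zS (sgS _ z'S) uz uz'; rewrite -(sgE z') ?E.
- by have [uS -> E] := cross _ _ _ z'S (sgS _ zS) uz' uz; rewrite -(sgE z) ?E.
have := D2 _ _ u (sgS _ zS) (sgS _ z'S) uz uz'.
rewrite /sg; case: eqP => [->|zx]; case: eqP => [->|z'x] // E; move: yS.
  by move: z'S; rewrite -E !inE => /predU1P[yx|->] //; case: z'x; rewrite -E.
by move: zS; rewrite E !inE => /predU1P[yx|->] //; case: zx; rewrite E.
Qed.

(** * Fans *)

(** Discard what precedes a later visit to [A], what follows an earlier visit to [C], and
    repetitions; each step shortens the path. With [A] the out-neighbours of [v], avoiding [A] after
    the start gives the no-shortcut clause of a fan. *)
Lemma path_tighten (T : finType) (e : rel T) (A C : {set T}) x p :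
  x \in A -> path e x p -> last x p \in C ->
  exists x' p', [/\ x' \in A, path e x' p', last x' p' \in C,
    uniq (x' :: p') & {subset x' :: p' <= x :: p}] /\
    [/\ {in p', forall z, z \notin A}
      & {in belast x' p', forall z, z \notin C}].
Proof.
have [n] := ubnP (size p); elim: n x p => // n IH x p; rewrite ltnS => lepn xA.
move=> pth lC.
have [/hasP[z zp zA]|/hasPn pA] := boolP (has [in A] p).
  case/splitPr: zp lepn pth lC => p1 p2; rewrite size_cat /= => lepn.
  rewrite cat_path last_cat => /andP[_ /andP[_ pth]] lC.
  have [|x' [p' [[? ? ? ? sub] ?]]] := IH z p2 _ zA pth lC.
    by apply: leq_trans lepn; rewrite addnS ltnS leq_addl.
  exists x', p'; split=> //; split=> // u /sub.
  by rewrite !inE mem_cat in_cons => ->; rewrite !orbT.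
have [/hasP[z zp zC]|/hasPn pC] := boolP (has [in C] (belast x p)).
  have [p1 [p2 [pE lz p2n]]] : exists p1 p2,
      [/\ p = p1 ++ p2, last x p1 = z & p2 != [::]].
    move: zp; clear; elim: p x => //= w p IHp x; rewrite inE.
    case/predU1P=> [->|zp]; first by exists [::], (w :: p).
    by have [p1 [p2 [-> <- ?]]] := IHp w zp; exists (w :: p1), p2.
  move: pth lepn; rewrite pE cat_path size_cat => /andP[pth _] lepn.
  have [||x' [p' [[? ? ? ? sub] ?]]] := IH x p1 _ xA pth; rewrite ?lz //.
    by apply: leq_trans lepn; rewrite -addn1 leq_add2l lt0n size_eq0.
  exists x', p'; split=> //; split=> // u /sub.
  by rewrite !inE mem_cat; case/orP=> ->; rewrite ?orbT.
case: (boolP (uniq (x :: p))) => [u|/negP nu].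
  by exists x, p; split; split.
case: (shortenP pth) lC => p' pth' u' sub lC.
have ltp : size p' < size p.
  rewrite ltnNge; apply/negP => le_pp; case: nu.
  have subx : {subset x :: p' <= x :: p}.
    by move=> z; rewrite !inE => /predU1P[->|/sub->]; rewrite ?eqxx ?orbT.
  exact: leq_size_uniq u' subx le_pp.
have [|x' [q [[? ? ? ? sub'] ?]]] := IH x p' (leq_trans ltp lepn) xA pth'.
  by [].
exists x', q; split=> //; split=> // z /sub'.
by rewrite !inE => /predU1P[->|/sub->]; rewrite ?eqxx ?orbT.
Qed.

Definition boundary (G : digraph) (X : {set G}) : {set G} :=
  [set y | (y \notin X) && [exists x in X, arc G x y]].

Lemma boundaryP (G : digraph) (X : {set G}) x y :
  x \in X -> arc G x y -> y \notin X -> y \in boundary X.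
Proof.
by move=> xX xy yX; rewrite inE yX; apply/existsP; exists x; rewrite xX.
Qed.

Lemma boundary_notin (G : digraph) (X : {set G}) y :
  y \in boundary X -> y \notin X.
Proof. by rewrite inE => /andP[]. Qed.

(** By [cardsUI] two inclusions suffice: the union of the boundaries of [X :&: Y] and [X :|: Y] lies
    in the union of those of [X] and [Y], and likewise for the intersections. *)
Lemma boundary_submod (G : digraph) (X Y : {set G}) :
  #|boundary (X :&: Y)| + #|boundary (X :|: Y)|
    <= #|boundary X| + #|boundary Y|.
Proof.
rewrite -cardsUI -[leqRHS]cardsUI; apply: leq_add.
  apply: subset_leq_card; apply/subsetP=> z; rewrite in_setU => /orP[].
    rewrite inE => /andP[+ /existsP[w /andP[]]]; rewrite in_setI negb_and.
    rewrite in_setI => + /andP[wX wY] wz; rewrite in_setU => /orP[zX|zY].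
      by rewrite (boundaryP wX).
    by rewrite (boundaryP wY) ?orbT.
  rewrite inE => /andP[+ /existsP[w /andP[]]]; rewrite in_setU negb_or.
  case/andP=> zX zY; rewrite !in_setU => /orP[wX|wY] wz.
    by rewrite (boundaryP wX).
  by rewrite (boundaryP wY) ?orbT.
apply: subset_leq_card; apply/subsetP=> z; rewrite !in_setI => /andP[].
rewrite inE => /andP[_ /existsP[w /andP[]]]; rewrite in_setI => /andP[wX wY wz].
move/boundary_notin; rewrite in_setU negb_or => /andP[zX zY].
by rewrite (boundaryP wX) ?(boundaryP wY).
Qed.

Lemma path_boundary (G : digraph) (X : {set G}) v p :
  v \in X -> path (arc G) v p -> last v p \notin X -> has [in boundary X] p.
Proof.
elim: p v => [|w p IH] v /= vX; first by rewrite vX.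
case/andP=> vw pth lX; have [wX|wX] := boolP (w \in X).
  by rewrite (IH w) ?orbT.
by rewrite (boundaryP vX vw wX).
Qed.

(* [P i] lists the internal vertices of the path from [v] to [i]; by the last
   clause, no arc from [v] shortcuts that path. *)
Definition fan (G : digraph) (v : G) (C I : {set G}) (P : G -> seq G) : Prop :=
  [/\ I \subset C,
      forall i, i \in I -> path (arc G) v (rcons (P i) i),
      forall i, i \in I -> uniq (P i),
      forall i z, i \in I -> z \in P i -> (z != v) && (z \notin C)
    & (forall i j z, i \in I -> j \in I -> z \in P i -> z \in P j -> i = j)
      /\ forall i z, i \in I -> z \in behead (rcons (P i) i) -> ~~ arc G v z].

(** Menger's theorem is applied in the digraph without [v], from the out-neighbours of [v] to
    [C]. *)
Lemma fan_exists (G : digraph) (v : G) (C : {set G}) k :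
  loopless G -> v \notin C ->
  (forall X : {set G}, v \in X -> [disjoint X & C] -> k <= #|boundary X|) ->
  exists (I : {set G}) P, #|I| = k /\ fan v C I P.
Proof.
move=> loopG vC Hk.
pose e : rel G := fun x y => [&& arc G x y, x != v & y != v].
pose A := [set y | arc G v y].
case: (menger e A C k) => [[S sep ltS]|[I0 [h0 [P0 [<- [H0 D0]]]]]].
  pose eS : rel G := fun x y => e x y && (y \notin S).
  (* [v] and all that its out-neighbours reach while avoiding [S]: this misses [C] because [S]
     separates, and its boundary lies in [S]. *)
  pose X := v |: [set x | [exists a in A :\: S, connect eS a x]].
  have vX : v \in X by rewrite !inE eqxx.
  have dX : [disjoint X & C].
    apply/pred0P=> x /=; apply/negP=> /andP[].
    rewrite !inE => /predU1P[->|]; first exact/negP.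
    case/existsP=> a /andP[]; rewrite in_setD => /andP[aS aA].
    case/connectP=> p pth -> lC.
    have pe : path e a p by apply: sub_path pth => x1 y1 /andP[].
    have /hasP[z + zS] := sep a p aA pe lC.
    rewrite inE => /predU1P[zE|zp]; first by move: zS; rewrite zE (negPf aS).
    suff: z \notin S by rewrite (zS : z \in S).
    elim: p (a) pth zp {aS aA lC pe} => //= w p IHp b.
    case/andP=> /andP[_ wS] /IHp{}IHp.
    by rewrite inE => /predU1P[->|].
  suff leS : #|boundary X| <= #|S|.
    by have := leq_trans (Hk X vX dX) leS; rewrite leqNgt ltS.
  apply: subset_leq_card; apply/subsetP=> y; rewrite inE => /andP[yX].
  case/existsP=> x /andP[xX xy]; apply: contraR yX => yS.
  rewrite !inE; case: (eqVneq y v) => //= yv; apply/existsP.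
  move: xX; rewrite !inE => /predU1P[xv|/existsP[a /andP[aA ax]]].
    by exists y; rewrite !inE yS -xv xy connect0.
  case: (eqVneq x v) => [xv|xv].
    by exists y; rewrite !inE yS -xv xy connect0.
  exists a; rewrite aA; apply: connect_trans ax (connect1 _).
  by rewrite /eS /e xy xv yv yS.
have /fin_all_exists[f Hf] i : exists xp : G * seq G, i \in I0 ->
    [/\ xp.1 \in A, path e xp.1 xp.2, last xp.1 xp.2 \in C,
    uniq (xp.1 :: xp.2) & {subset xp.1 :: xp.2 <= h0 i :: P0 i}] /\
    [/\ {in xp.2, forall z, z \notin A}
      & {in belast xp.1 xp.2, forall z, z \notin C}].
  have [iI|] := boolP (i \in I0); last by exists (v, [::]).
  have [hA pth lC _] := H0 i iI.
  by have [x [p xp]] := path_tighten hA pth lC; exists (x, p).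
have lk : linkage e A C I0 (fst \o f) (snd \o f).
  split=> [i /Hf[[]] //|i j z iI jI /= zi zj].
  have [[_ _ _ _ si] _] := Hf i iI; have [[_ _ _ _ sj] _] := Hf j jI.
  by apply: (D0 i j z); rewrite ?si ?sj.
pose l i := last (f i).1 (f i).2.
have linj : {in I0 &, injective l}.
  move=> i j iI jI ij; apply: lk.2 iI jI (mem_last _ _) _.
  by rewrite /= -/(l i) ij mem_last.
have [|||h [P [[H D] E]]] := @linkage_reindex _ _ _ _ _ (l @: I0) _ l _ lk.
- by move=> i iI; apply: imset_f.
- by move=> i iI; apply: mem_last.
- by rewrite card_in_imset.
have lE z : z \in l @: I0 -> last (h z) (P z) = z by case/E=> i _ [<- -> ->].
(* A fan lists internal vertices only: the start [h z] is kept and the end [z] is dropped. *)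
exists (l @: I0), (fun z => belast (h z) (P z)).
have rE z : z \in l @: I0 -> rcons (belast (h z) (P z)) z = h z :: P z.
  by move=> zI; rewrite [RHS]lastI lE.
split; first by rewrite card_in_imset.
have neq_v z u : z \in l @: I0 -> u \in h z :: P z -> u != v.
  move=> /H[+ pth _ _]; rewrite inE => hA; case/predU1P=> [->|].
    by apply: contraTneq hA => ->; rewrite loopG.
  elim: (P z) (h z) pth => //= w p IHp b /andP[/and3P[_ _ wv] /IHp{}IHp].
  by case/predU1P=> [->|].
split=> [|z zI|z zI|z u zI uz|].
- by apply/subsetP=> z zI; have [_ _ + _] := H z zI; rewrite lE.
- rewrite rE //=; have [] := H z zI; rewrite inE => -> pth _ _ /=.
  by apply: sub_path pth => a b /andP[].
- by have [_ _ _] := H z zI; rewrite lastI rcons_uniq => /andP[].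
- rewrite (neq_v z) //; last by rewrite lastI mem_rcons inE uz orbT.
  have [i iI [_ hE PE]] := E z zI; have [_ [_ ->]] := Hf i iI => //.
  by rewrite /= in hE PE; rewrite -hE -PE.
split=> [i j z iI jI zi zj|i z iI].
  by apply: (D i j z) => //; rewrite lastI mem_rcons inE ?zi ?zj orbT.
rewrite rE //=; have [i0 i0I [_ _ /= ->]] := E i iI => zp.
by have [_ [/(_ z zp) + _]] := Hf i0 i0I; rewrite inE.
Qed.

Lemma fan_disjoint (G : digraph) (v : G) (C I : {set G}) P i j z :
  fan v C I P -> i \in I -> j \in I ->
  z \in rcons (P i) i -> z \in rcons (P j) j -> i = j.
Proof.
move=> [/subsetP IC _ _ nC [D _]] iI jI; rewrite !mem_rcons !inE.
case/predU1P=> [->|zi] /predU1P[zE|zj] //.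
- by have := nC j i jI zj; rewrite IC // andbF.
- by have := nC i z iI zi; rewrite zE IC // andbF.
- exact: D zi zj.
Qed.

Lemma fan_boundary (G : digraph) (v : G) (C I X : {set G}) P i :
  fan v C I P -> v \in X -> i \in I -> i \notin X ->
  exists2 z, z \in boundary X & z \in rcons (P i) i.
Proof.
move=> [_ pth _ _ _] vX iI iX.
have := path_boundary vX (pth i iI); rewrite last_rcons => /(_ iX) /hasP[z ? ?].
by exists z.
Qed.

(** Each fan path has to leave [X] through a boundary vertex, and the paths are disjoint apart from
    [v]. *)
Lemma leq_fan_boundary (G : digraph) (v : G) (C I X : {set G}) P :
  fan v C I P -> v \in X -> [disjoint X & I] -> #|I| <= #|boundary X|.
Proof.
move=> fanP vX dXI.
have iX i : i \in I -> i \notin X.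
  move=> iI; apply: contraTN dXI => iX.
  by apply/pred0Pn; exists i; rewrite /= iX.
have /fin_all_exists[f Hf] i :
    exists z, i \in I -> z \in boundary X /\ z \in rcons (P i) i.
  have [iI|] := boolP (i \in I); last by exists v.
  by have [z] := fan_boundary fanP vX iI (iX i iI); exists z.
rewrite -(card_in_imset (f := f)).
  by apply: subset_leq_card; apply/subsetP=> _ /imsetP[i /Hf[? _] ->].
move=> i j iI jI fij; have [_ fi] := Hf i iI; have [_ fj] := Hf j jI.
by apply: (fan_disjoint fanP iI jI fi); rewrite fij.
Qed.

(** * The descent *)

(* Singletons are admitted as degenerate cycles, so that the descent can start
   from any vertex. *)
Definition semicycle (G : digraph) (C : seq G) : bool :=
  uniq C && ((size C == 1) || cycle (arc G) C).

(* The new cycle leaves [C] at [c], takes the fan path to the first endpoint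
   [w] met when walking along [C] from [c], and then follows [C] back to [c]. *)
Lemma reroute (G : digraph) (C : seq G) c v (I : {set G}) P i0 :
  semicycle C -> c \in C -> v \notin C -> arc G c v ->
  fan v [set x in C] I P -> i0 \in I ->
  exists C' w, [/\ semicycle C', v \in C', w \in I, {subset I <= C'}
    & forall x, x \in C' -> [|| x == v, x \in P w | x \in C]].
Proof.
move=> /andP[uC cC] cinC vC cv [/subsetP IC pth uP nP _] i0I.
have [n C1 rC] := rot_to cinC.
have memC x : (x \in rcons C1 c) = (x \in C).
  by rewrite mem_rcons -rC mem_rot.
(* [rcons C1 c] lists [C] from the vertex after [c] round to [c]; as [w] is its first vertex in [I],
   all of [I] lies in [w :: b]. *)
have [a [w [b [E wI naI]]]] : exists a w b,
    [/\ rcons C1 c = a ++ w :: b, w \in I & ~~ has [in I] a].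
  have : has [in I] (rcons C1 c).
    by apply/hasP; exists i0; rewrite ?memC //; have := IC _ i0I; rewrite inE.
  by case/split_find=> w a b wI nI; exists a, w, b; rewrite cat_rcons.
have lw : last w b = c.
  by have := congr1 (last c) E; rewrite last_rcons last_cat.
have pw : path (arc G) w b.
  case/orP: cC => [/eqP sz|].
    have := congr1 size E; rewrite size_rcons size_cat /=.
    have := congr1 size rC; rewrite size_rot sz /= => -[<-].
    by case: b {E lw} => //= ? ?; rewrite !addnS.
  by rewrite -[cycle _ _](rot_cycle n) rC /= E cat_path /= => /and3P[].
have memb x : x \in w :: b -> x \in C.
  by rewrite -memC E mem_cat => ->; rewrite orbT.
have uwb : uniq (w :: b).
  have : uniq (rcons C1 c).
    by rewrite rcons_uniq -[_ && _]/(uniq (c :: C1)) -rC rot_uniq.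
  by rewrite E cat_uniq => /and3P[].
exists (v :: P w ++ w :: b), w; split=> //.
- apply/andP; split; last first.
    apply/orP; right; rewrite /= rcons_cat /= -cat_rcons cat_path pth //=.
    by rewrite last_rcons rcons_path pw lw cv.
  rewrite /= cat_uniq uP // uwb mem_cat negb_or andbT -!andbA.
  apply/and3P; split.
  + by apply/negP=> /(nP w _ wI); rewrite eqxx.
  + by apply: contra vC; apply: memb.
  + apply/hasPn=> x /memb xC; apply/negP=> /(nP w _ wI).
    by rewrite inE xC andbF.
- by rewrite mem_head.
- move=> i iI; have := IC _ iI; rewrite inE -memC E in_cons !mem_cat.
  by case/orP=> [/(hasPn naI)|->]; rewrite ?orbT // iI.
move=> x; rewrite inE mem_cat.
by case/or3P=> [->|->|/memb->]; rewrite ?orbT.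
Qed.

(* By counting: otherwise the out-neighbours of [v] all lie in [boundary X],
   except for the first vertex of the path to [w], while that path also meets
   [boundary X]. *)
Lemma fan_escape (G : digraph) (v : G) (C I X : {set G}) P w :
  fan v C I P -> v \in X -> [disjoint X & C] -> w \in I ->
  #|boundary X| < outdeg v ->
  exists2 y, arc G v y & (y \in X) && (y \notin P w).
Proof.
move=> fanP vX dXC wI ltd.
have wX : w \notin X.
  have [/subsetP IC _ _ _ _] := fanP.
  by apply: contraTN dXC => wX; apply/pred0Pn; exists w; rewrite /= wX IC.
have [z zX zP] := fan_boundary fanP vX wI wX.
have [[y /and3P[vy yX yP]]|none] :=
    altP (@existsP _ (fun y => [&& arc G v y, y \in X & y \notin P w])).
  by exists y; rewrite ?yX.
have [_ _ _ _ [_ short]] := fanP.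
(* The first vertex after [v] on the path to [w]; the no-shortcut clause makes it the only
   out-neighbour of [v] there. *)
pose q := seq.head v (rcons (P w) w).
have headP y : arc G v y -> y \in rcons (P w) w -> y = q.
  move=> vy; have := short w y wI; rewrite /q; case: (rcons _ _) => //= a s sh.
  by rewrite inE => /predU1P[//|/sh]; rewrite vy.
(* Adding [q] is offset by removing [z], which leaves room for at most [#|boundary X|]
   out-neighbours, too few. *)
suff sub : [set y | arc G v y] \subset q |: (boundary X :\ z).
  have := leq_trans ltd (subset_leq_card sub).
  rewrite cardsU1 (cardsD1 z (boundary X)) zX add1n.
  by case: (q \notin _); rewrite ?ltnn // add0n ltnNge leqnSn.
apply/subsetP=> y; rewrite inE => vy; rewrite !inE.
have [//|yq /=] := eqVneq y q.
have yP : y \notin rcons (P w) w by apply: contraNN yq => /(headP y vy)->.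
have -> : y != z by apply: contraNneq yP => ->.
have yX : y \notin X.
  apply/negP=> yX; case/existsP: none; exists y; rewrite vy yX.
  by move: yP; rewrite mem_rcons inE negb_or => /andP[].
by have := boundaryP vX vy yX; rewrite inE.
Qed.

Lemma min_boundary_exists (G : digraph) (v : G) (C : {set G}) :
  v \notin C ->
  exists X : {set G}, [/\ v \in X, [disjoint X & C] &
    forall X' : {set G}, v \in X' -> [disjoint X' & C] ->
      #|boundary X| <= #|boundary X'|].
Proof.
move=> vC; pose ok (X : {set G}) := (v \in X) && [disjoint X & C].
have ok1 : ok [set v] by rewrite /ok set11 disjoints1.
case: (arg_minnP (fun X => #|boundary X|) ok1) => X /andP[vX dX] min.
by exists X; split=> // X' vX' dX'; apply: min; rewrite /ok vX'.
Qed.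

Lemma closed_path (G : digraph) (Y : {set G}) v p :
  boundary Y = set0 -> v \in Y -> path (arc G) v p -> {subset p <= Y}.
Proof.
move=> bY; elim: p v => // w p IH v vY /= /andP[vw pth].
have wY : w \in Y by apply/negPn/negP=> /(boundaryP vY vw); rewrite bY inE.
by move=> x; rewrite inE => /predU1P[->|/(IH w wY pth)].
Qed.

(** Induction on [#|X|]. Minimality of [Y] forbids an empty boundary of [X], so the fan has a path;
    for this the cycles are kept inside [Y]. *)
Lemma fan_descent (G : digraph) (t : nat) (Y : {set G}) :
  2 <= t -> loopless G -> (forall v : G, t <= outdeg v) ->
  boundary Y = set0 ->
  (forall Z, Z != set0 -> Z \subset Y -> boundary Z = set0 -> Z = Y) ->
  forall (C : seq G) c v (X : {set G}),
  semicycle C -> {subset C <= Y} -> c \in C -> v \notin C -> arc G c v ->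
  v \in X -> [disjoint X & [set x in C]] ->
  (forall X' : {set G}, v \in X' -> [disjoint X' & [set x in C]] ->
      #|boundary X| <= #|boundary X'|) ->
  exists (C : seq G) c v (I : {set G}) P,
    [/\ uniq C, cycle (arc G) C, c \in C, v \notin C & arc G c v]
    /\ #|I| = t /\ fan v [set x in C] I P.
Proof.
move=> t2 loopG degG bY Ymin C c v X.
have [n] := ubnP #|X|; elim: n => // n IH in C c v X *; rewrite ltnS => leXn.
move=> scC CY cC vC cv vX dX Xmin.
have vC' : v \notin [set x in C] by rewrite inE.
have [letX|ltt] := leqP t #|boundary X|.
  have [|I [P [It fanP]]] := fan_exists (k := t) loopG vC'.
    by move=> X' vX' dX'; apply: leq_trans letX (Xmin X' vX' dX').
  exists C, c, v, I, P; split=> //.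
  (* [C] is not a singleton here, as it contains [t >= 2] fan endpoints. *)
  case/andP: scC => uC cycC; split=> //; case/orP: cycC => // /eqP sz.
  have [/subset_leq_card + _ _ _ _] := fanP.
  rewrite It cardsE => /leq_trans/(_ (card_size _)).
  by rewrite sz => /(leq_trans t2).
have [I [P [Ik fanP]]] := fan_exists loopG vC' Xmin.
have vY : v \in Y.
  by apply/negPn/negP=> /(boundaryP (CY _ cC) cv); rewrite bY inE.
(* If the boundary of [X] were empty, so would be that of [X :&: Y] by submodularity; then
   [X :&: Y = Y], although [c] is in [Y] and not in [X]. *)
have [i0 i0I] : exists i0, i0 \in I.
  apply/set0Pn; rewrite -card_gt0 Ik lt0n; apply/eqP=> b0.
  have XY : X :&: Y = Y.
    apply: Ymin; rewrite ?subsetIr //.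
      by apply/set0Pn; exists v; rewrite inE vX.
    apply/eqP; rewrite -cards_eq0 -leqn0.
    apply: leq_trans (leq_addr _ _) (leq_trans (boundary_submod X Y) _).
    by rewrite b0 bY cards0.
  have := CY _ cC; rewrite -XY inE => /andP[cX _].
  by move/pred0P/(_ c): dX; rewrite /= cX inE cC.
have [C' [w [scC' vC1 wI IC' C'P]]] := reroute scC cC vC cv fanP i0I.
have [y vy /andP[yX yP]] := fan_escape fanP vX dX wI (leq_trans ltt (degG v)).
have yC : y \notin C.
  by apply/negP=> yC; move/pred0P/(_ y): dX; rewrite /= yX inE yC.
have yC' : y \notin C'.
  apply/negP=> /C'P; rewrite (negPf yP) (negPf yC) !orbF => /eqP yv.
  by move: vy; rewrite yv loopG.
have C'Y : {subset C' <= Y}.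
  move=> x /C'P /or3P[/eqP->//|xP|/CY//].
  have [_ pth _ _ _] := fanP; apply: (closed_path bY vY (pth w wI)).
  by rewrite mem_rcons inE xP orbT.
have [|X0 [yX0 dX0 X0min]] := @min_boundary_exists G y [set x in C'].
  by rewrite inE.
have nX0 x : x \in C' -> x \notin X0.
  move=> xC'; apply/negP=> xX0.
  by move/pred0P/(_ x): dX0; rewrite /= xX0 inE xC'.
apply: (IH C' v y (X :&: X0)) => //.
- apply: leq_trans leXn; apply: proper_card; apply/properP; split.
    exact: subsetIl.
  by exists v; rewrite // inE vX nX0.
- by rewrite inE yX.
- by apply: disjointWl dX0; apply: subsetIr.
move=> X' yX' dX'; apply: leq_trans (X0min X' yX' dX').
(* Submodularity leaves [#|boundary X| <= #|boundary (X :|: X0)|] to show. The union contains [v]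
   and misses [I], since [X] misses [C] and [X0] misses [C']. *)
rewrite -(leq_add2r #|boundary (X :|: X0)|).
apply: leq_trans (boundary_submod _ _) _; rewrite addnC leq_add2l -Ik.
apply: (leq_fan_boundary fanP); first by rewrite inE vX.
apply/pred0P=> i /=; apply/negP=> /andP[+ iI].
rewrite inE (negPf (nX0 i (IC' i iI))) orbF.
have [/subsetP/(_ i iI) iC _ _ _ _] := fanP.
by move=> iX; move/pred0P/(_ i): dX; rewrite /= iX iC.
Qed.

Lemma fan_cycle_exists (G : digraph) (t : nat) :
  2 <= t -> 0 < #|G| -> loopless G -> (forall v : G, t <= outdeg v) ->
  exists (C : seq G) c v (I : {set G}) P,
    [/\ uniq C, cycle (arc G) C, c \in C, v \notin C & arc G c v]
    /\ #|I| = t /\ fan v [set x in C] I P.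
Proof.
move=> t2 G0 loopG degG.
pose closed (Z : {set G}) := (Z != set0) && (boundary Z == set0).
have [|Y /minsetP[/andP[/set0Pn[c cY] /eqP bY] Ymin] _] :=
    @minset_exists _ closed setT.
  apply/andP; split; first by rewrite -card_gt0 cardsT.
  by apply/eqP/setP=> y; rewrite !inE.
have /card_gt0P[v] : 0 < outdeg c by apply: leq_trans (degG c); apply: ltnW.
rewrite inE => cv.
have vc : v \notin [:: c].
  by rewrite inE; apply: contraTneq cv => ->; rewrite loopG.
have [|X [vX dX Xmin]] := @min_boundary_exists G v [set x in [:: c]].
  by rewrite inE.
apply: (@fan_descent G t Y t2 loopG degG bY _ [:: c] c v X) => //.
- by move=> Z Z0 ZY bZ; apply: Ymin => //; rewrite /closed Z0 bZ eqxx.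
- by move=> x; rewrite inE => /eqP->.
- by rewrite inE.
Qed.

(** * Subdivisions of wheels *)

(** Converts branch vertices [g] and lists [p u v] of internal vertices into an embedding; the
    subdivision lengths are read off the lists. *)
Lemma contains_subdivision_paths (F G : digraph) (g : F -> G)
    (p : F -> F -> seq G) :
  injective g ->
  (forall u v, arc F u v -> [/\ path (arc G) (g u) (rcons (p u v) (g v)),
     uniq (p u v) & forall w, g w \notin p u v]) ->
  (forall u v u' v' z, arc F u v -> arc F u' v' ->
     z \in p u v -> z \in p u' v' -> (u, v) = (u', v')) ->
  contains_subdivision G F.
Proof.
move=> ginj pP pD; pose q (e : arcs F) := p (tail e) (head e).
have arcP (e : arcs F) : arc F (tail e) (head e) by exact: (valP e).
exists (fun e => size (q e)).
pose f (x : subdiv_vertex (fun e => size (q e))) : G := match x with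
  | inl u => g u
  | inr a => nth (g (tail (tag a))) (q (tag a)) (tagged a)
  end.
have fq e (i : 'I_(size (q e))) :
    f (inr (Tagged (fun e => 'I_(size (q e))) i)) \in q e.
  by rewrite /= mem_nth.
(* All four kinds of arcs of the subdivision are instances of this single form, [i] counting the
   arcs along the path over [e]. *)
have step (e : arcs F) i : i <= size (q e) ->
    arc G (nth (g (tail e)) (g (tail e) :: q e) i)
      (nth (g (tail e)) (rcons (q e) (g (head e))) i).
  move=> lei; have [/(pathP (g (tail e))) pth _ _] := pP _ _ (arcP e).
  have := pth i; rewrite size_rcons ltnS => /(_ lei).
  case: i {pth} lei => //= i lti.
  by rewrite -/(q e) [X in arc G X _ -> _]nth_rcons lti.
exists f.
  move=> [u|[e i]] [u'|[e' i']].
  - by move=> /ginj->.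
  - move=> E; have := fq e' i'; rewrite -E /=.
    by have [_ _ /(_ u)/negPf->] := pP _ _ (arcP e').
  - move=> E; have := fq e i; rewrite E /=.
    by have [_ _ /(_ u')/negPf->] := pP _ _ (arcP e).
  - move=> E; have ze := fq e i; have ze' := fq e' i'; rewrite E in ze.
    have ee : e = e'.
      apply: val_inj; have := pD _ _ _ _ _ (arcP e) (arcP e') ze ze'.
      by rewrite /tail /head -!surjective_pairing.
    subst e'; move: E => /= /eqP; rewrite nth_uniq //.
      by move/eqP/val_inj=> ->.
    by have [] := pP _ _ (arcP e).
move=> [u|[e i]] [u'|[e' i']] /=.
- case/existsP=> e /and3P[/eqP<- /eqP<- /nilP q0].
  by have := step e 0 isT; rewrite q0.
- case/andP=> /eqP<- /eqP i0; have := step e' 0 isT => /=.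
  by rewrite i0 nth_rcons; case: (q e') (i') => // -[].
- case/andP=> /eqP<- ie; have := step e i.+1 (ltn_ord i).
  by rewrite nth_rcons ie ltn_neqAle ie.
case/andP=> /eqP ee /eqP; subst e' => ii; have := step e i' (ltnW (ltn_ord i')).
by rewrite nth_rcons ltn_ord ii.
Qed.

Lemma uniq_flatten_nth (T : eqType) (ss : seq (seq T)) i j z :
  uniq (flatten ss) -> z \in nth [::] ss i -> z \in nth [::] ss j -> i = j.
Proof.
elim: ss i j => [|s ss IH] [|i] [|j] //=; rewrite ?nth_nil // cat_uniq.
- case/and3P=> _ /hasPn nz _ zs zj; have /nz/negP[] // : z \in flatten ss.
  apply/flattenP; exists (nth [::] ss j) => //; apply: mem_nth.
  by rewrite ltnNge; apply/negP=> /(nth_default [::]) E; rewrite E in zj.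
- case/and3P=> _ /hasPn nz _ zj zs; have /nz/negP[] // : z \in flatten ss.
  apply/flattenP; exists (nth [::] ss i) => //; apply: mem_nth.
  by rewrite ltnNge; apply/negP=> /(nth_default [::]) E; rewrite E in zj.
by case/and3P=> _ _ us zi zj; rewrite (IH i j us zi zj).
Qed.

(* A cycle is cut into blocks [x.1 :: x.2]: a branch vertex, followed by the
   internal vertices of the path to the next branch vertex. *)
Definition pieces (T : Type) (L : seq (T * seq T)) : seq (seq T) :=
  [seq x.1 :: x.2 | x <- L].

Lemma cut_at (T : eqType) (B : pred T) s :
  exists s0 L, [/\ s = s0 ++ flatten (pieces L), ~~ has B s0,
    all (fun x => B x.1) L & all (fun x => ~~ has B x.2) L].
Proof.
elim: s => [|x s [s0 [L [-> s0B LB LnB]]]]; first by exists [::], [::].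
case: (boolP (B x)) => Bx; last by exists (x :: s0), L; rewrite /= negb_or Bx.
by exists [::], ((x, s0) :: L); rewrite /= Bx s0B.
Qed.

Lemma path_pieces (T : eqType) (e : rel T) (L : seq (T * seq T)) x0 i :
  sorted e (flatten (pieces L)) -> i.+1 < size L ->
  path e (nth x0 L i).1 (rcons (nth x0 L i).2 (nth x0 L i.+1).1).
Proof.
elim: L i => [|[b s] [|[b' s'] L] IH] [|i] //=.
  by rewrite cat_path rcons_path /= => /and3P[-> ->].
rewrite cat_path => /andP[_ /path_sorted sL].
exact: (IH i sL).
Qed.

(** One statement for all the wheels: [r] may be any relation whose arcs are rim arcs, spokes, or an
    arc from index 0 to the apex. [B] is the set of branch vertices on the rim, with [c] at index 0;
    [c] has to be a fan endpoint only if [r] has a spoke to index 0. *)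
Lemma fan_wheel (G : digraph) (v c : G) (s : seq G) (B I : {set G}) P m
    (r : rel (option 'I_m)) :
  cycle (arc G) (c :: s) -> uniq (c :: s) -> v \notin c :: s ->
  fan v [set x in c :: s] I P ->
  c \in B -> {subset B <= c :: s} -> #|B| = m -> {subset B :\ c <= I} ->
  (forall i j, r (Some i) (Some j) -> j = ordS i) -> ~~ r None None ->
  (forall i, r (Some i) None -> i = 0 :> nat /\ arc G c v) ->
  (forall i, r None (Some i) -> 0 < i \/ c \in I) ->
  contains_subdivision G (Digraph r).
Proof.
move=> cyc us vC [_ pth uP nP [PD _]] cB BC Bm BI rSS rNN rSN rNS.
have [s0 [L0 [sE s0B L0B L0n]]] := cut_at [in B] s.
pose L := (c, s0) :: L0; pose x0 := (c, [::] : seq G).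
have CE : c :: s = flatten (pieces L) by rewrite sE.
have LB i : i < size L -> (nth x0 L i).1 \in B.
  by move: i; apply/(all_nthP x0 (a := fun y => y.1 \in B)); rewrite /= cB.
have Ln i x : i < size L -> x \in (nth x0 L i).2 -> x \notin B.
  move=> lti; have /(all_nthP x0)/(_ i lti)/hasPn nB :
    all (fun y => ~~ has [in B] y.2) L by rewrite /= s0B.
  exact: nB.
have nthE i : i < size L ->
    nth [::] (pieces L) i = (nth x0 L i).1 :: (nth x0 L i).2.
  by move=> lti; rewrite (nth_map x0).
have uL : uniq (flatten (pieces L)) by rewrite -CE.
have LC i x : i < size L -> x \in (nth x0 L i).1 :: (nth x0 L i).2 ->
    x \in c :: s.
  move=> lti xi; rewrite CE; apply/flattenP; exists (nth [::] (pieces L) i).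
    by apply: mem_nth; rewrite size_map.
  by rewrite nthE.
have Linj i j x : i < size L -> j < size L ->
    x \in (nth x0 L i).1 :: (nth x0 L i).2 ->
    x \in (nth x0 L j).1 :: (nth x0 L j).2 -> i = j.
  move=> lti ltj xi xj.
  by apply: (@uniq_flatten_nth _ _ i j x uL); rewrite nthE.
have Lm : size L = m.
  rewrite -Bm -(size_map fst).
  have <- : [set x in map fst L] = B.
    apply/setP=> x; rewrite inE; apply/idP/idP.
      case/mapP=> y /(nthP x0)[i lti <-] ->; exact: LB.
    move=> xB; have := BC x xB; rewrite CE => /flattenP[_ /mapP[y yL ->]].
    rewrite inE => /predU1P[->|]; first exact: map_f.
    case/(nthP x0): yL => i lti <- /(Ln i x lti).
    by rewrite xB.
  rewrite cardsE; apply/esym/card_uniqP; apply/(uniqP c) => i j.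
  rewrite !inE size_map => lti ltj; rewrite !(nth_map x0) // => E.
  by apply: (Linj i j (nth x0 L i).1); rewrite ?mem_head // E mem_head.
have ltL (i : 'I_m) : i < size L by rewrite Lm.
(* Branch vertex [i] is the first vertex of block [i] and the rest of the block subdivides the rim
   arc. Spokes are fan paths; the arc to the apex stays a single arc. *)
pose g (o : option 'I_m) := if o is Some i then (nth x0 L i).1 else v.
pose p (o o' : option 'I_m) := match o, o' with
  | Some i, Some _ => (nth x0 L i).2
  | None, Some i => P (nth x0 L i).1
  | _, _ => [::]
  end.
have gI i : r None (Some i) -> (nth x0 L i).1 \in I.
  move=> ri; have := LB _ (ltL i).
  case: (eqVneq (nth x0 L i).1 c) => [E _|ic iB].
    case: (rNS i ri) => [i0|]; last by rewrite E.
    have := @Linj i 0 c (ltL i) isT.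
    rewrite /= mem_head -E mem_head => /(_ isT isT) iE.
    by rewrite iE in i0.
  by apply: BI; rewrite in_setD1 ic.
have gC i : g (Some i) \in c :: s by rewrite (LC i) ?mem_head.
apply: (@contains_subdivision_paths (Digraph r) G g p).
- move=> [i|] [j|] //= E.
  + congr Some; apply: val_inj; apply: (@Linj i j (nth x0 L i).1) => //.
      exact: mem_head.
    by rewrite E mem_head.
  + by move: vC; rewrite -E -/(g (Some i)) gC.
  + by move: vC; rewrite E -/(g (Some j)) gC.
- move=> [i|] [j|] //= rij.
  + rewrite (rSS i j rij); split.
    (* An extra block with branch vertex [c] closes the cycle, so the last rim path is treated like
       the others. *)
    * have : sorted (arc G) (flatten (pieces (rcons L x0))).
        by rewrite /pieces map_rcons flatten_rcons /= -sE cats1.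
      move/path_pieces=> /(_ x0 i); rewrite size_rcons ltnS => /(_ (ltL i)).
      rewrite !nth_rcons ltL /=.
      case: (ltnP i.+1 (size L)).
        by move=> lti; rewrite modn_small //; rewrite Lm in lti.
      move=> le; have E : size L = i.+1 by apply/eqP; rewrite eqn_leq le ltL.
      have -> : i.+1 %% m = 0 by rewrite -E Lm modnn.
      by rewrite -E eqxx.
    * have := uL; rewrite -(cat_take_drop i (pieces L)) flatten_cat cat_uniq.
      rewrite (drop_nth [::]) ?size_map ?nthE //=.
      by case/and4P=> _ _ _; rewrite cat_uniq => /andP[].
    move=> [k|] /=; last first.
      by apply: contra vC => vi; apply: (LC i); rewrite ?inE ?vi ?orbT.
    by apply: contraL (LB _ (ltL k)) => /(Ln _ _ (ltL i)).
  + have [i0 cv] := rSN i rij; split=> //; by rewrite i0 /= cv.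
  + have bI := gI j rij; split; [exact: pth | exact: uP |].
    move=> w; apply/negP=> /(nP _ _ bI) /andP[wv]; rewrite inE.
    by case: w wv => [k|]; rewrite ?gC ?eqxx.
  + by rewrite (negPf rNN) in rij.
move=> [i|] [j|] [i'|] [j'|] z //= r1 r2 z1 z2.
- have E : i = i'.
    by apply: val_inj; apply: (@Linj i i' z) => //; rewrite inE ?z1 ?z2 orbT.
  by rewrite (rSS _ _ r1) (rSS _ _ r2) E.
- have /andP[_] := nP _ _ (gI _ r2) z2; rewrite inE (LC i) //.
  by rewrite inE z1 orbT.
- have /andP[_] := nP _ _ (gI _ r1) z1; rewrite inE (LC i') //.
  by rewrite inE z2 orbT.
congr (_, Some _); apply: val_inj; apply: (@Linj j j' (nth x0 L j).1) => //.
  exact: mem_head.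
by rewrite (PD _ _ z (gI _ r1) (gI _ r2) z1 z2) mem_head.
Qed.

Lemma rotate_cycle (T : finType) (e : rel T) (C : seq T) x :
  uniq C -> cycle e C -> x \in C ->
  exists s, [/\ uniq (x :: s), cycle e (x :: s) & x :: s =i C].
Proof.
move=> uC cC /rot_to[n s E]; exists s; rewrite -E rot_uniq rot_cycle.
by split=> // y; rewrite mem_rot.
Qed.

Theorem theorem1p18 (t : nat) (ht : 2 <= t) (G : digraph)
    (Gnonempty : 0 < #|G|) (Gloopless : loopless G)
    (Gmindeg : forall v : G, t <= outdeg v) :
  (contains_subdivision G (wheel1 t) \/ contains_subdivision G (wheel2 t.+1))
  /\ (contains_subdivision G (cycle_plus t) /\ contains_subdivision G (wheel2 t)).
Proof.
have [C [c [v [I [P [[uC cC cinC vC cv] [It fanP]]]]]]] :=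
  fan_cycle_exists ht Gnonempty Gloopless Gmindeg.
have IC : {subset I <= C}.
  by have [/subsetP + _ _ _ _] := fanP => IC x /IC; rewrite inE.
have wheel m (r : rel (option 'I_m)) x (B : {set G}) :
    x \in B -> {subset B <= C} -> #|B| = m -> {subset B :\ x <= I} ->
    (forall i j, r (Some i) (Some j) -> j = ordS i) -> ~~ r None None ->
    (forall i, r (Some i) None -> i = 0 :> nat /\ x = c) ->
    (forall i, r None (Some i) -> 0 < i \/ x \in I) ->
    contains_subdivision G (Digraph r).
  move=> xB BC Bm BI rSS rNN rSN rNS.
  have [s [us cs sC]] := rotate_cycle uC cC (BC x xB).
  apply: (@fan_wheel G v x s B I P m r) => //.
  - by rewrite sC.
  - suff -> : [set y in x :: s] = [set y in C] by [].
    by apply/setP=> y; rewrite !inE -[_ || _]/(y \in x :: s) sC.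
  - by move=> y /BC; rewrite sC.
  - by move=> i /rSN[-> ->].
have ISub x : {subset I :\ x <= I} by move=> y; rewrite in_setD1 => /andP[].
have [i0 i0I] : exists i, i \in I.
  by apply/set0Pn; rewrite -card_gt0 It; apply: leq_trans ht.
have plus : contains_subdivision G (cycle_plus t).
  apply: (wheel _ _ i0 I) => // [i j /eqP->//|i _]; by right.
have [cI|cI] := boolP (c \in I).
  (* Index 0, placed at [c], has both the arc to [v] and a spoke; [wheel2] omits that spoke. *)
  split; [left|split=> //].
    by apply: (wheel _ _ c I) => // [i j /eqP->|i /eqP|i _]; [| | right].
  by apply: (wheel _ _ c I) => // [i j /eqP->|i /eqP|i _]; [| | right].
(* [c] joins the [t] endpoints as a branch vertex without a spoke, at index 0. *)
split; [right|split=> //].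
  apply: (wheel _ _ c (c |: I)) => //.
  - exact: setU11.
  - by move=> x; rewrite in_setU1 => /predU1P[->|/IC].
  - by rewrite cardsU1 cI It.
  - by move=> x; rewrite !inE; case: eqP.
  - by move=> i j /eqP.
  - by move=> i /eqP.
  - by move=> i; rewrite /= lt0n; left.
(* Giving up the endpoint [i0] brings the rim back to [t] branch vertices. *)
apply: (wheel _ _ c (c |: I :\ i0)) => //.
- exact: setU11.
- by move=> x; rewrite in_setU1 => /predU1P[->//|/ISub/IC].
- by rewrite cardsU1 in_setD1 (negPf cI) andbF -It (cardsD1 i0 I) i0I.
- by move=> x; rewrite !inE; case: eqP => //= _ /andP[].
- by move=> i j /eqP.
- by move=> i /eqP.
- by move=> i; rewrite /= lt0n; left.
Qed.
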